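(* Let $\mathfrak n$ be the Lie algebra of a $6$-dimensional nilpotent Lie group $N$ with an invariant $SU(3)$ structure $(\omega,\psi^+)$, and let $D$ be a non-singular self-adjoint derivation of $\mathfrak n$ which is diagonalised by the unitary basis $\{e_i\}$ in which $\omega=e^{14}-e^{23}+e^{56}$ and $\psi^+=\mathrm{Re}\bigl((e^1+ie^4)\wedge(e^2-ie^3)\wedge(e^5+ie^6)\bigr)$. Let $Y$ be the simply connected Lie group of the solvable extension $\mathfrak s=\mathfrak n\oplus\mathbb R e_7$, $\mathrm{ad}_{e_7}|_{\mathfrak n}=D$, with $G_2$ structure $\varphi=\omega\wedge e^7+\psi^+$. If $(Y,\varphi)$ is conformal to a $G_2$-holonomy manifold (i.e. $\varphi$ is conformally parallel), then the $SU(3)$ structure on $N$ is half-flat, that is, $\hat d\psi^+=0$ and $\hat d(\omega\wedge\omega)=0$.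
   Context: Notation: $e^{ij\dots}=e^i\wedge e^j\wedge\cdots$; $\hat d$ is the Chevalley--Eilenberg differential of $\mathfrak n$ (exterior derivative of left-invariant forms on $N$), $d$ that of $\mathfrak s$. The inner product on $\mathfrak n$ is the one for which $e_1,\dots,e_6$ is orthonormal; it is extended to an inner product $g$ on $\mathfrak s$ with $e_7$ a unit vector orthogonal to $\mathfrak n$. The bracket on $\mathfrak s$ is $[e_7,U]=DU$, $[U,V]=[U,V]_{\mathfrak n}$ for $U,V\in\mathfrak n$. With $\psi^-=\mathrm{Im}\bigl((e^1+ie^4)\wedge(e^2-ie^3)\wedge(e^5+ie^6)\bigr)$ one has $*\varphi=\psi^-\wedge e^7+\tfrac12\omega\wedge\omega$. The $G_2$ structure $\varphi$ is conformally parallel if its intrinsic torsion lies in the class $\mathcal X_4$, i.e. $d\varphi=3\tau\wedge\varphi$ and $d{*\varphi}=4\tau\wedge{*\varphi}$ for a closed $1$-form $\tau$; in the present setting $\tau=me^7$, so the condition reads $d\varphi=3m\,e^7\wedge\varphi$, $d{*\varphi}=4m\,e^7\wedge{*\varphi}$ for a real constant $m\neq0$. *)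

(* Defs.v *)
From HB Require Import structures.
From mathcomp Require Import all_boot all_order all_algebra all_fingroup.
From mathcomp Require Import complex.
From mathcomp Require Import boolp functions reals.
Set Implicit Arguments.
Unset Strict Implicit.
Unset Printing Implicit Defensive.
Import Order.TTheory GRing.Theory Num.Theory.
Local Open Scope ring_scope.

Section LieAlgebra.
Context {R : fieldType} {V : vectType R}.
Implicit Types (br : V -> V -> V) (D : 'End(V)) (U W : {vspace V}).

Definition lie_bracket br : Prop :=
  [/\ forall x, linear (br x),
      forall y, linear (br^~ y),
      forall x, br x x = 0
    & forall x y z, br x (br y z) + br y (br z x) + br z (br x y) = 0].

Definition bracket_space br U W : {vspace V} :=
  <<[seq br x y | x <- vbasis U, y <- vbasis W]>>%VS.

Definition lower_central br (k : nat) : {vspace V} :=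
  iter k (bracket_space br fullv) fullv.

Definition nilpotent_bracket br : Prop :=
  exists k, lower_central br k = 0%VS.

Definition derivation br D : Prop :=
  forall x y, D (br x y) = br (D x) y + br x (D y).

End LieAlgebra.

(* Left-invariant forms on a Lie group with values in [K] are forms on its Lie
   algebra [V].  The type [kform K V k] does not impose that a form be
   alternating and multilinear; every form below is built from linear
   functionals by operations that preserve these properties. *)

Definition kform (K : Type) (V : Type) (k : nat) : Type := ('I_k -> V) -> K.

Definition catf (V : Type) (p q : nat) (x : 'I_p -> V) (y : 'I_q -> V) :
    'I_(p + q) -> V :=
  fun i => match fintype.split i with inl a => x a | inr b => y b end.

Definition form1 (K V : Type) (f : V -> K) : kform K V 1 := fun x => f (x ord0).

Definition pullback (K V W : Type) (k : nat) (f : V -> W) (a : kform K W k) :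
    kform K V k :=
  fun x => a (f \o x).

Definition wedge (K : fieldType) (V : Type) (p q : nat)
    (a : kform K V p) (b : kform K V q) : kform K V (p + q) :=
  fun x => ((p`! * q`!)%N%:R)^-1 *
    \sum_(s : 'S_(p + q)) (-1) ^+ s *
      a (fun i => x (s (lshift q i))) * b (fun j => x (s (rshift p j))).

Notation "a ⋀ b" := (wedge a b) (at level 40, left associativity).

(* d a (x_0, .., x_(k+1)) is the sum over i < j' of
     (-1)^(i+j') a([x_i, x_j'], x_0, .., without x_i and x_j', .., x_(k+1)).
   The larger index is j' = lift i j, and i < lift i j amounts to i <= j. *)
Definition CE_d (K : fieldType) (V : Type) (br : V -> V -> V) (k : nat)
    (a : kform K V k.+1) : kform K V k.+2 :=
  fun x => \sum_(i < k.+2) \sum_(j < k.+1 | (i <= j)%N)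
    (-1) ^+ (i + lift i j) *
    a (@catf V 1 k (fun=> br (x i) (x (lift i j)))
                   (fun l => x (lift i (lift j l)))).

Section Metric.
Context {R : fieldType} {V : vectType R} {n : nat}.
Variable e : n.-tuple V.

(* The dual basis, numbered from 1: [coframe k] is e^k for 1 <= k <= n. *)
Definition coframe (k : nat) : kform R V 1 :=
  form1 (fun v => \sum_(i < n | i.+1 == k) coord e i v).

(* e^1 ⋀ .. ⋀ e^n *)
Definition volume_form : kform R V n :=
  fun x => \det (\matrix_(i, j) coord e j (x i)).

(* The inner product for which e is orthonormal. *)
Definition inner (u v : V) : R := \sum_(i < n) coord e i u * coord e i v.

Definition self_adjoint (D : 'End(V)) : Prop :=
  forall u v, inner (D u) v = inner u (D v).

(* Hodge star for [inner] and the unit volume form [vol]: the sum over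
   increasing multi-indices I of a(e_I) vol(e_I, -), written as a sum over all
   multi-indices divided by k!. *)
Definition hodge (vol : kform R V n) (k m : nat) (kmn : (k + m)%N = n)
    (a : kform R V k) : kform R V m :=
  fun y => (k`!%:R)^-1 *
    \sum_(f : {ffun 'I_k -> 'I_n})
      a (fun i => tnth e (f i)) *
      vol (catf (fun i => tnth e (f i)) y \o cast_ord (esym kmn)).

End Metric.

Section SU3.
Context {R : realType} {V : vectType R}.
Implicit Types (e : 6.-tuple V) (omega : kform R V 2) (psi : kform R V 3).

Definition omega_of e : kform R V 2 :=
  coframe e 1 ⋀ coframe e 4 - coframe e 2 ⋀ coframe e 3 + coframe e 5 ⋀ coframe e 6.

Definition complex_form k (a b : kform R V k) : kform R[i] V k :=
  fun x => Complex (a x) (b x).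

Definition psi_plus_of e : kform R V 3 :=
  fun x => complex.Re
    ((complex_form (coframe e 1) (coframe e 4)
      ⋀ complex_form (coframe e 2) (- coframe e 3)
      ⋀ complex_form (coframe e 5) (coframe e 6)) x).

(* (omega, psi) is an SU(3) structure with unitary basis e. *)
Definition SU3_structure omega psi e : Prop :=
  [/\ basis_of fullv e, omega = omega_of e & psi = psi_plus_of e].

Definition half_flat (br : V -> V -> V) omega psi : Prop :=
  CE_d br psi = 0 /\ CE_d br (omega ⋀ omega : kform R V 4) = 0.

End SU3.

Section Extension.
Context {R : realType} {V : vectType R}.

(* s = n + R e_7, with e_7 = (0, 1) *)
Definition ext : vectType R := (V * R^o)%type.

(* [e_7, u] = D u *)
Definition ext_bracket (br : V -> V -> V) (D : 'End(V)) (x y : ext) : ext :=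
  (br x.1 y.1 + (x.2 : R) *: D y.1 - (y.2 : R) *: D x.1, 0).

Definition ext_frame (e : 6.-tuple V) : 7.-tuple ext :=
  [tuple of rcons [seq (v, 0) | v <- e] (0, 1)].

Definition G2_form (e : 6.-tuple V) (omega : kform R V 2) (psi : kform R V 3) :
    kform R ext 3 :=
  (pullback fst omega ⋀ coframe (ext_frame e) 7 : kform R ext 3)
  + pullback fst psi.

(* The orientation is that of the G2 form, i.e. of omega^3 ⋀ e^7; since
   omega^3 = - 6 e^123456, the unit volume form is - e^1234567.  With this
   choice the star of G2_form is psi^- ⋀ e^7 + 1/2 omega ⋀ omega. *)
Definition G2_star (e : 6.-tuple V) (a : kform R ext 3) : kform R ext 4 :=
  hodge (ext_frame e) (- volume_form (ext_frame e)) (erefl : (3 + 4 = 7)%N) a.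

(* Torsion in the class X_4.  The Lee form tau is determined by phi, hence
   left-invariant like phi. *)
Definition conformally_parallel (br : V -> V -> V) (D : 'End(V))
    (e : 6.-tuple V) (phi : kform R ext 3) : Prop :=
  exists tau : {linear ext -> R^o},
    [/\ CE_d (ext_bracket br D) (form1 tau : kform R ext 1) = 0,
        CE_d (ext_bracket br D) phi
          = ((form1 tau : kform R ext 1) ⋀ phi : kform R ext 4) *+ 3
      & CE_d (ext_bracket br D) (G2_star e phi)
          = ((form1 tau : kform R ext 1) ⋀ G2_star e phi : kform R ext 5) *+ 4].

End Extension.
Arguments ext {R} V.

(* Main.v *)
(* Restrict the two equations of [conformally_parallel] to arguments in n, viewed
   inside s as the vectors (v, 0).  Closedness of tau gives
   0 = d tau (e_7, v) = - tau (D v), and D is onto, so tau vanishes on n and both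
   right-hand sides restrict to 0.  Since n is a subalgebra of s, d restricts to
   the differential of n; phi restricts to psi, and *phi to 1/2 omega ⋀ omega.
   For the last fact, the restriction of *phi involves only the multi-indices
   containing 7, which leaves the sum of the 4 x 4 minors complementary to the
   terms of omega; it is compared with omega ⋀ omega as polynomials in the
   coordinates of the arguments. *)
Require Import Defs.
From mathcomp Require Import all_boot all_order all_algebra all_fingroup.
From mathcomp Require Import boolp functions reals complex ring zify.
Set Implicit Arguments.
Unset Strict Implicit.
Unset Printing Implicit Defensive.
Import Order.TTheory GRing.Theory Num.Theory.
Local Open Scope ring_scope.

(** * Determinants with natural-number indices *)

Section Determinants.
Context {R : comPzRingType}.

(* Entries are indexed by [nat] so that minors, unlike [row'] and [col'], compute
   when the row and column numbers are concrete. *)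
Definition ndet m (M : nat -> nat -> R) := \det (\matrix_(i < m, j < m) M i j).

Definition nminor (M : nat -> nat -> R) (j i k : nat) := M i.+1 (bump j k).

Lemma ndet_expand_row0 m (M : nat -> nat -> R) :
  ndet m.+1 M = \sum_(j < m.+1) (-1) ^+ j * M 0%N j * ndet m (nminor M j).
Proof.
rewrite /ndet (expand_det_row _ ord0); apply: eq_bigr => j _.
rewrite mxE /cofactor add0n mulrCA mulrA; congr (_ * \det _).
by apply/matrixP => i k; rewrite !mxE.
Qed.

(** One term of the row expansion survives. Repeated use strips the rows of frame vectors from a
    value of the volume form. *)
Lemma ndet_delta_row0 m (M : nat -> nat -> R) (a : 'I_m.+1) :
  (forall j : 'I_m.+1, M 0%N j = (j == a)%:R) ->
  ndet m.+1 M = (-1) ^+ a * ndet m (nminor M a).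
Proof.
move=> Ma; rewrite ndet_expand_row0 (bigD1 a) //= Ma eqxx mulr1 big1 ?addr0 //.
by move=> j /negPf ja; rewrite Ma ja mulr0 mul0r.
Qed.

Lemma ndet1 M : ndet 1 M = M 0%N 0%N.
Proof. by rewrite /ndet det_mx11 mxE. Qed.

Lemma ndet2 M : ndet 2 M = M 0%N 0%N * M 1%N 1%N - M 0%N 1%N * M 1%N 0%N.
Proof.
by rewrite ndet_expand_row0 !big_ord_recl big_ord0 !ndet1 /nminor /bump /=; ring.
Qed.

Lemma ndet3 (M : nat -> nat -> R) :
  ndet 3 M = M 0%N 0%N * (M 1%N 1%N * M 2%N 2%N - M 1%N 2%N * M 2%N 1%N)
           - M 0%N 1%N * (M 1%N 0%N * M 2%N 2%N - M 1%N 2%N * M 2%N 0%N)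
           + M 0%N 2%N * (M 1%N 0%N * M 2%N 1%N - M 1%N 1%N * M 2%N 0%N).
Proof.
by rewrite ndet_expand_row0 !big_ord_recl big_ord0 !ndet2 /nminor /=; ring.
Qed.

(** Written out so that the comparison of 4 x 4 minors with [omega ⋀ omega] becomes an identity of
    polynomials. *)
Lemma ndet4 (M : nat -> nat -> R) :
  ndet 4 M =
    M 0%N 0%N * (M 1%N 1%N * (M 2%N 2%N * M 3%N 3%N - M 2%N 3%N * M 3%N 2%N)
           - M 1%N 2%N * (M 2%N 1%N * M 3%N 3%N - M 2%N 3%N * M 3%N 1%N)
           + M 1%N 3%N * (M 2%N 1%N * M 3%N 2%N - M 2%N 2%N * M 3%N 1%N))
  - M 0%N 1%N * (M 1%N 0%N * (M 2%N 2%N * M 3%N 3%N - M 2%N 3%N * M 3%N 2%N)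
           - M 1%N 2%N * (M 2%N 0%N * M 3%N 3%N - M 2%N 3%N * M 3%N 0%N)
           + M 1%N 3%N * (M 2%N 0%N * M 3%N 2%N - M 2%N 2%N * M 3%N 0%N))
  + M 0%N 2%N * (M 1%N 0%N * (M 2%N 1%N * M 3%N 3%N - M 2%N 3%N * M 3%N 1%N)
           - M 1%N 1%N * (M 2%N 0%N * M 3%N 3%N - M 2%N 3%N * M 3%N 0%N)
           + M 1%N 3%N * (M 2%N 0%N * M 3%N 1%N - M 2%N 1%N * M 3%N 0%N))
  - M 0%N 3%N * (M 1%N 0%N * (M 2%N 1%N * M 3%N 2%N - M 2%N 2%N * M 3%N 1%N)
           - M 1%N 1%N * (M 2%N 0%N * M 3%N 2%N - M 2%N 2%N * M 3%N 0%N)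
           + M 1%N 2%N * (M 2%N 0%N * M 3%N 1%N - M 2%N 1%N * M 3%N 0%N)).
Proof.
by rewrite ndet_expand_row0 !big_ord_recl big_ord0 !ndet3 /nminor /=; ring.
Qed.

End Determinants.

(** * Wedge products, pullbacks and the Chevalley-Eilenberg differential *)

Section Forms.
Context {K : fieldType} {V W : Type}.

Lemma catf_comp (f : W -> V) p q (x : 'I_p -> W) (y : 'I_q -> W) :
  f \o catf x y = catf (f \o x) (f \o y).
Proof. by apply/funext => i; rewrite /catf /=; case: fintype.split. Qed.

Lemma wedge0 p q (b : kform K V q) : (0 : kform K V p) ⋀ b = 0.
Proof.
apply/funext => x; rewrite /wedge big1 ?mulr0 // => s _.
by rewrite /= mulr0 mul0r.
Qed.

Lemma wedge_form1 (a b : kform K V 1) (x : 'I_2 -> V) :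
  (a ⋀ b) x = a (fun=> x ord0) * b (fun=> x ord_max)
            - a (fun=> x ord_max) * b (fun=> x ord0).
Proof.
(* The sum over ['S_2] is the Leibniz formula for the matrix with the values of [a] in row 0 and
   those of [b] in row 1. *)
pose M (i j : nat) : K := (if i == 0 then a else b) (fun=> x (inord j)).
transitivity (ndet 2 M).
  rewrite /wedge mul1n invr1 mul1r; apply: eq_bigr => s _.
  rewrite -mulrA; congr (_ * _); rewrite big_ord_recl big_ord1 !mxE /M /= !inord_val.
  congr (a _ * b _); apply/funext => i /=; rewrite ord1; congr (x (s _)); exact: val_inj.
rewrite ndet2 /M /=.
rewrite (_ : inord 0 = ord0); last by apply: val_inj; rewrite /= inordK.
by rewrite (_ : inord 1 = ord_max) //; apply: val_inj; rewrite /= inordK.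
Qed.

(** The differential only evaluates the form on arguments and their brackets, and [f] respects
    both. *)
Lemma CE_d_pullback (brV : V -> V -> V) (brW : W -> W -> W) (f : W -> V) k
    (a : kform K V k.+1) : {morph f : x y / brW x y >-> brV x y} ->
  CE_d brW (pullback f a) = pullback f (CE_d brV a).
Proof.
move=> fM; apply/funext => x; apply: eq_bigr => i _; apply: eq_bigr => j _.
congr (_ * _); congr (a _); apply/funext => l.
have := congr1 (fun h : 'I_(1 + k) -> V => h l) (catf_comp f
  (fun=> brW (x i) (x (lift i j))) (fun l => x (lift i (lift j l)))).
by rewrite /comp /= fM => ->.
Qed.

Lemma CE_dZ (br : V -> V -> V) k c (a : kform K V k.+1) :
  CE_d br (fun x => c * a x) = fun x => c * CE_d br a x.
Proof.
apply/funext => x; rewrite /CE_d mulr_sumr; apply: eq_bigr => i _.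
by rewrite mulr_sumr; apply: eq_bigr => j _; rewrite mulrCA.
Qed.

End Forms.

(** Against an alternating [G] the antisymmetrisation in the wedge is redundant: reindexing the
    summand of [s] by [s^-1] produces a second sign that cancels the first, so all [(p + q)!]
    summands are equal. *)
Lemma sum_wedge_alternating (K : fieldType) (V : Type) (I : finType) (v : I -> V) p q
    (a : kform K V p) (b : kform K V q) (G : {ffun 'I_(p + q) -> I} -> K) :
  (forall (f : {ffun 'I_(p + q) -> I}) (s : 'S_(p + q)),
    G [ffun i => f (s i)] = (-1) ^+ s * G f) ->
  \sum_(f : {ffun 'I_(p + q) -> I}) (a ⋀ b) (fun i => v (f i)) * G f =
  ((p + q)`!%:R / (p`! * q`!)%N%:R) *
    \sum_(f : {ffun 'I_(p + q) -> I})
      a (fun i => v (f (lshift q i))) * b (fun i => v (f (rshift p i))) * G f.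
Proof.
move=> Galt; rewrite [_ / _]mulrC -mulrA /wedge.
under eq_bigr => f _ do rewrite -mulrA.
rewrite -mulr_sumr; congr (_ * _).
under eq_bigr => f _ do rewrite mulr_suml.
rewrite exchange_big /= mulr_natl.
set S := (X in X *+ _).
suff E : forall s : 'S_(p + q), true -> \sum_(f : {ffun 'I_(p + q) -> I})
    (-1) ^+ s * a (fun i => v (f (s (lshift q i)))) *
    b (fun j => v (f (s (rshift p j)))) * G f = S.
  by rewrite (eq_bigr _ E) sumr_const; congr (_ *+ _); rewrite -card_Sn; apply: eq_card.
move=> s _; rewrite /S.
rewrite (reindex (fun f : {ffun 'I_(p + q) -> I} => [ffun i => f (s^-1%g i)])) /=; last first.
  exists (fun f : {ffun 'I_(p + q) -> I} => [ffun i => f (s i)]) => f _;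
    by apply/ffunP => i; rewrite !ffunE ?permK ?permKV.
apply: eq_bigr => f _; rewrite Galt odd_permV.
rewrite [RHS](_ : _ = (-1) ^+ s * (-1) ^+ s *
   (a (fun i => v (f (lshift q i))) * b (fun i => v (f (rshift p i))) * G f)); last first.
  by rewrite -expr2 sqrr_sign mul1r.
have E1 : (fun i => v ([ffun i => f (s^-1%g i)] (s (lshift q i)))) = fun i => v (f (lshift q i)).
  by apply/funext => i; rewrite ffunE permK.
have E2 : (fun i => v ([ffun i => f (s^-1%g i)] (s (rshift p i)))) = fun i => v (f (rshift p i)).
  by apply/funext => i; rewrite ffunE permK.
rewrite E1 E2 -!mulrA; congr (_ * _); rewrite [RHS]mulrCA; congr (_ * _).
exact: mulrCA.
Qed.

(** * Forms that vanish on a zero argument *)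

Section Null.
Context {K : fieldType} {V : zmodType}.

Definition null_at0 k (a : kform K V k) := forall x i, x i = 0 -> a x = 0.

(** In the summand of [s] the zero argument sits in slot [s^-1 i], which belongs either to [a] or to
    [b]. *)
Lemma null_at0_wedge p q (a : kform K V p) (b : kform K V q) :
  null_at0 a -> null_at0 b -> null_at0 (a ⋀ b).
Proof.
move=> a0 b0 x i xi0; rewrite /wedge big1 ?mulr0 // => s _.
case: (split_ordP ((s^-1)%g i)) => j sj.
  by rewrite (a0 _ j) ?mulr0 ?mul0r // -sj permKV.
by rewrite (b0 _ j) ?mulr0 // -sj permKV.
Qed.

End Null.

(** * Coordinates in the frame extended by e_7 *)

Section Frames.
Context {R : realType} {V : vectType R} (e : 6.-tuple V).
Context (e_basis : basis_of fullv e).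

Definition incl (v : V) : ext V := (v, 0).

Let e_free : free e := basis_free e_basis.

Lemma ext_frame_sum (k : 'I_7 -> R) :
  \sum_i k i *: (ext_frame e)`_i =
  (\sum_(i < 6) k (widen_ord (leqnSn 6) i) *: e`_i, k ord_max) :> ext V.
Proof.
have sz : size [seq (v, 0) : ext V | v <- e] = 6%N by rewrite size_map size_tuple.
rewrite big_ord_recr /= [in X in _ + X]nth_rcons sz ltnn eqxx.
under eq_bigr => i _.
  rewrite nth_rcons sz ltn_ord (nth_map 0) ?size_tuple ?ltn_ord //.
  over.
apply/eqP; rewrite -pair_eqE /=; apply/andP; split; apply/eqP.
  rewrite /= raddf_sum /= scaler0 addr0; apply: eq_bigr => i _ //.
rewrite /= raddf_sum /= big1 ?add0r => [|i _]; first exact: mulr1.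
exact: scaler0.
Qed.

Lemma ext_frame_free : free (ext_frame e).
Proof.
apply/freeP => k; rewrite ext_frame_sum => k_0 i.
have k0 := congr1 fst k_0; have /= kmax := congr1 snd k_0.
have [->|ni] := eqVneq i ord_max; first exact: kmax.
have i6 : (i < 6)%N by rewrite ltn_neqAle ni /= -ltnS.
have /freeP/(_ (fun i => k (widen_ord (leqnSn 6) i)) k0 (Ordinal i6)) <- := e_free.
by congr k; apply: val_inj.
Qed.

Lemma coord_ext_frame (k : 'I_7 -> R) v :
  (forall i : 'I_6, coord e i v = k (widen_ord (leqnSn 6) i)) ->
  forall i, coord (ext_frame e) i (v, k ord_max) = k i.
Proof.
move=> kE i; rewrite -[RHS](coord_sum_free k i ext_frame_free) ext_frame_sum.
congr (coord _ _ (_, _)); rewrite [LHS](coord_basis e_basis) ?memvf //.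
by apply: eq_bigr => j _; rewrite kE.
Qed.

Lemma coord_incl (i : 'I_7) v :
  coord (ext_frame e) i (incl v) = if (i < 6)%N then coord e (inord i) v else 0.
Proof.
pose k (i : 'I_7) := if (i < 6)%N then coord e (inord i) v else 0.
rewrite -[RHS]/(k i) -(@coord_ext_frame k v) // => j.
by rewrite /k (ltn_ord j) inord_val.
Qed.

Lemma coord_ext_frame_tnth (i j : 'I_7) :
  coord (ext_frame e) i (tnth (ext_frame e) j) = (j == i)%:R.
Proof. by rewrite (tnth_nth 0) coord_free ?ext_frame_free // eq_sym. Qed.

Lemma coord_fst_ext_frame (k : nat) (j : 'I_7) : (k < 6)%N ->
  coord e (inord k) (tnth (ext_frame e) j).1 = (j == k :> nat)%:R.
Proof.
move=> k6; rewrite (tnth_nth 0) nth_rcons size_map size_tuple.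
case: ltnP => j6.
  rewrite (nth_map 0) ?size_tuple //= (coord_free (Ordinal j6)) //.
  by rewrite -val_eqE /= inordK // eq_sym.
(* The remaining vector is e_7, whose component in n is 0. *)
have -> : j = 6%N :> nat by apply/eqP; rewrite eqn_leq j6 -ltnS ltn_ord.
by rewrite /= raddf0 gtn_eqF.
Qed.

End Frames.

(** * Coordinate expansions of omega and of its square *)

Lemma coframeE (R : realType) (V : vectType R) n (e : n.+1.-tuple V) k (x : 'I_1 -> V) :
  (k < n.+1)%N -> coframe e k.+1 x = coord e (inord k) (x ord0).
Proof.
move=> kn; rewrite /coframe /form1 (big_pred1 (inord k)) // => i.
by rewrite eqSS /= -val_eqE /= inordK.
Qed.

(* [omega_of e] is the sum of c e^(a+1) ⊗ e^(b+1) over the entries (c, (a, b)). *)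
Definition omega_terms : seq (int * (nat * nat)) :=
  [:: (1, (0, 3)%N); (-1, (3, 0)%N); (-1, (1, 2)%N); (1, (2, 1)%N);
      (1, (4, 5)%N); (-1, (5, 4)%N)].

Section Omega.
Context {R : realType} {V : vectType R} (e : 6.-tuple V).

Lemma omega_of_sum (x : 'I_2 -> V) :
  omega_of e x = \sum_(t <- omega_terms)
    t.1%:~R * (coord e (inord t.2.1) (x ord0) * coord e (inord t.2.2) (x ord_max)).
Proof.
rewrite !big_cons big_nil.
have wE a b : (a < 6)%N -> (b < 6)%N -> (coframe e a.+1 ⋀ coframe e b.+1) x =
    coord e (inord a) (x ord0) * coord e (inord b) (x ord_max)
  - coord e (inord a) (x ord_max) * coord e (inord b) (x ord0).
  by move=> a6 b6; rewrite wedge_form1 !coframeE.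
rewrite /omega_of -[LHS]/((coframe e 1 ⋀ coframe e 4) x
  - (coframe e 2 ⋀ coframe e 3) x + (coframe e 5 ⋀ coframe e 6) x).
by rewrite !wE //=; ring.
Qed.

Definition coordn (y : 'I_4 -> V) (i j : nat) : R := coord e (inord j) (y (inord i)).

(** For a fixed pair of terms, the sum over permutations is a Leibniz formula, transposed because
    permutations act on the arguments. The factor 4 is [2! * 2!]. *)
Lemma omega_square (y : 'I_4 -> V) :
  (omega_of e ⋀ omega_of e) y = 4%:R^-1 *
    \sum_(t <- omega_terms) \sum_(u <- omega_terms) t.1%:~R * u.1%:~R *
      ndet 4 (fun i j => coordn y i (nth 0 [:: t.2.1; t.2.2; u.2.1; u.2.2] j)%N).
Proof.
rewrite /wedge; congr (_ * _).
under eq_bigr => s _ do rewrite !omega_of_sum -mulrA big_distrlr mulr_sumr.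
rewrite exchange_big; apply: eq_bigr => t _.
under eq_bigr => s _ do rewrite mulr_sumr.
rewrite exchange_big; apply: eq_bigr => u _.
rewrite /ndet -det_tr mulr_sumr; apply: eq_bigr => s _.
rewrite !big_ord_recl big_ord0 !mxE /coordn /= !inord_val mulr1.
set a := lshift 2 ord0; set b := lshift 2 ord_max.
set c := rshift 2 ord0; set d := rshift 2 ord_max.
rewrite (_ : lift ord0 (lift ord0 (lift ord0 ord0)) = d); last exact: val_inj.
rewrite (_ : lift ord0 (lift ord0 ord0) = c); last exact: val_inj.
rewrite (_ : lift ord0 ord0 = b); last exact: val_inj.
rewrite (_ : ord0 = a); last exact: val_inj.
(* Abstracted, since [ring] would try to compute the parity of [s]. *)
by move: ((-1) ^+ _) => sgn_s; ring.
Qed.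

End Omega.

(** * Restriction to n of the Hodge dual of the G2 form *)

Section Star.
Context {R : realType} {V : vectType R} (e : 6.-tuple V).
Context (e_basis : basis_of fullv e).
Context (y : 'I_4 -> V).

(** This is e^1234567 on three frame vectors followed by four vectors of n, in blocks so that
    permuting [f] is a block multiplication. *)
Definition frame_det (f : 'I_3 -> 'I_7) : R :=
  \det (col_mx (\matrix_(i < 3, j < 7) (f i == j)%:R)
               (\matrix_(i < 4, j < 7) coord (ext_frame e) j (incl (y i))) : 'M_(3 + 4)).

Lemma volume_form_frame_det (f : 'I_3 -> 'I_7) :
  volume_form (ext_frame e)
    (catf (fun i => tnth (ext_frame e) (f i)) (@incl R V \o y)
       \o cast_ord (esym (erefl : (3 + 4 = 7)%N))) = frame_det f.
Proof.
rewrite /volume_form /frame_det; congr (\det _); apply/matrixP => i j.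
rewrite [LHS]mxE [RHS]mxE /= cast_ord_id /catf.
by case: fintype.split => k; rewrite mxE // coord_ext_frame_tnth.
Qed.

Lemma frame_det_perm (f : 'I_3 -> 'I_7) (s : 'S_3) :
  frame_det (f \o s) = (-1) ^+ s * frame_det f.
Proof.
rewrite /frame_det -det_perm.
set A := (X in _ = _ * \det (col_mx X _)); set B := (X in col_mx _ X).
have -> : \matrix_(i < 3, j < 7) (((f \o s) i == j)%:R : R) = perm_mx s *m A.
  by rewrite -row_permE; apply/matrixP => i j; rewrite !mxE.
have -> : col_mx (perm_mx s *m A) B = block_mx (perm_mx s) 0 0 1%:M *m col_mx A B.
  by rewrite mul_block_col !mul0mx mul1mx addr0 add0r.
by rewrite det_mulmx det_ublock det1 mulr1.
Qed.

(** The e^7 column is zero: all seven rows are vectors of n. *)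
Lemma frame_det_horizontal f : (forall i, f i != ord_max) -> frame_det f = 0.
Proof.
move=> fmax; rewrite /frame_det (expand_det_col _ (ord_max : 'I_7)) big1 // => i _.
rewrite [X in X * _](_ : _ = 0) ?mul0r //.
rewrite mxE; case: fintype.split => k; rewrite mxE; first by rewrite (negPf (fmax k)).
by rewrite coord_incl.
Qed.

(** Columns [a], [b] and 6 are deleted in turn; [unbump a b] is the position of column [b] once
    column [a] is gone. *)
Lemma frame_det_vertical (a b : nat) (f : 'I_3 -> 'I_7) :
  (a < 6)%N -> (b < 6)%N -> a != b ->
  (forall i, f i = nth 0 [:: a; b; 6] i :> nat)%N ->
  frame_det f = (-1) ^+ (a + unbump a b) *
    ndet 4 (fun i j => coordn e y i (bump a (bump (unbump a b) j))).
Proof.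
move=> a6 b6 ab fE.
pose M (i j : nat) : R := if (i < 3)%N then (j == nth 0 [:: a; b; 6] i)%N%:R
                   else if (j < 6)%N then coordn e y (i - 3) j else 0.
have -> : frame_det f = ndet 7 M.
  rewrite /frame_det /ndet; congr (\det _); apply/matrixP => i j.
  rewrite [RHS]mxE mxE /M; case: (split_ordP i) => k ->; rewrite mxE /=.
    by rewrite -val_eqE /= fE eq_sym.
  rewrite coord_incl //= addKn /coordn inord_val; by case: ltnP.
have ba : bump a (unbump a b) = b by apply: unbumpK; rewrite inE eq_sym.
have b'5 : (unbump a b < 5)%N.
  by move: b6; rewrite -{1}ba /bump; lia.
have aK : (inord a : 'I_7) = a :> nat by rewrite inordK // ltnW.
have b'K : (inord (unbump a b) : 'I_6) = unbump a b :> nat by rewrite inordK // ltnW.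
have K4 : (inord 4 : 'I_5) = 4%N :> nat by rewrite inordK.
rewrite (@ndet_delta_row0 _ _ _ (inord a)) => [|j]; last first.
  by rewrite /M /= -val_eqE /= aK.
rewrite (@ndet_delta_row0 _ _ _ (inord (unbump a b))) => [|j]; last first.
  rewrite /nminor /M /= -val_eqE /= aK b'K.
  by rewrite -[in LHS]ba (inj_eq (can_inj (bumpK a))).
(* Column 6 is now in position 4, so this expansion has sign +1. *)
rewrite (@ndet_delta_row0 _ _ _ (inord 4)) => [|j]; last first.
  rewrite /nminor /M /= -val_eqE /= aK b'K K4.
  by congr (_%:R); rewrite /bump; lia.
rewrite aK b'K K4.
rewrite -[(-1) ^+ 4]signr_odd mul1r exprD -mulrA; congr (_ * (_ * \det _)).
apply/matrixP => i j; rewrite !mxE /nminor /M /=.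
have j4 := ltn_ord j; have -> : bump 4 j = j by rewrite /bump; lia.
rewrite ifT; last by rewrite /bump; lia.
by rewrite (_ : i.+3 - 3 = i)%N //; lia.
Qed.

Lemma null_at0_complex_form k (a b : kform R V k) :
  null_at0 a -> null_at0 b -> null_at0 (complex_form a b).
Proof. by move=> a0 b0 x i xi0; rewrite /complex_form (a0 x i) // (b0 x i). Qed.

Lemma null_at0_coframe k : null_at0 (coframe e k).
Proof.
move=> x i xi0; rewrite /coframe /form1 big1 // => j _.
have -> : ord0 = i by rewrite (ord1 i).
by rewrite xi0 raddf0.
Qed.

Lemma null_at0_psi_plus : null_at0 (psi_plus_of e).
Proof.
have null3 := null_at0_coframe 3.
move=> x i xi0; rewrite /psi_plus_of.
rewrite (null_at0_wedge (null_at0_wedge _ _) _ xi0) //;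
  apply: null_at0_complex_form; try exact: null_at0_coframe.
move=> x' j xj0; rewrite -[LHS]/(- coframe e 3 x') (null3 _ j) ?oppr0 //.
Qed.

Lemma pullback_G2_star :
  pullback (@incl R V) (G2_star e (G2_form e (omega_of e) (psi_plus_of e))) y =
  2%:R^-1 * (omega_of e ⋀ omega_of e) y.
Proof.
rewrite /pullback /G2_star /hodge.
pose E (f : {ffun 'I_3 -> 'I_7}) i := tnth (ext_frame e) (f i).
pose om : kform R (ext V) 2 := pullback fst (omega_of e).
(* The sign comes from the orientation chosen in [G2_star]. *)
pose G (f : {ffun 'I_3 -> 'I_7}) := - frame_det f.
transitivity ((3`!)%:R^-1 * \sum_(f : {ffun 'I_3 -> 'I_7})
   (om ⋀ coframe (ext_frame e) 7) (E f) * G f).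
  congr (_ * _); apply: eq_bigr => f _.
  rewrite /G -volume_form_frame_det -[X in _ * X]/(- volume_form _ _) !mulrN.
  rewrite volume_form_frame_det; congr (- _).
  rewrite -[X in X * _]/((om ⋀ coframe (ext_frame e) 7) (E f)
                       + psi_plus_of e (fst \o E f)) mulrDl.
  rewrite [X in _ + X](_ : _ = 0) ?addr0 //.
  (* Each term of psi vanishes: either some [f i] is e_7, which [fst] kills, or
     the rows of the determinant are all horizontal. *)
  have [[i /eqP fi]|fN] := pselect (exists i, f i == ord_max).
    rewrite (@null_at0_psi_plus _ i) ?mul0r //= /E fi.
    by rewrite (tnth_nth 0) nth_rcons size_map size_tuple.
  rewrite frame_det_horizontal ?mulr0 // => i.
  by apply/negP => fi; apply: fN; exists i.
rewrite (@sum_wedge_alternating _ _ _ _ 2 1); last first.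
  move=> f s; rewrite /G mulrN -frame_det_perm; congr (- frame_det _).
  by apply/funext => i; rewrite ffunE.
pose F a b : {ffun 'I_3 -> 'I_7} := [ffun i : 'I_3 => inord (nth 0 [:: a; b; 6] i)%N].
have FE a b (i : 'I_3) : (a < 6)%N -> (b < 6)%N -> F a b i = nth 0%N [:: a; b; 6] i :> nat.
  move=> a6 b6; rewrite ffunE inordK //.
  by case: i => [[|[|[|]]]] //= _; apply: ltnW.
(* The factor [1/3!] of the star times [3!/(2! * 1!)] leaves 1/2. Each term of omega, tensored with
   e^7, is nonzero on exactly one multi-index, namely [F]. *)
transitivity (2%:R^-1 * \sum_(t <- omega_terms) t.1%:~R * G (F t.2.1 t.2.2)).
  rewrite mulrA; congr (_ * _).
    by rewrite mulKf // pnatr_eq0.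
  have omega_lt : all (fun t => (t.2.1 < 6) && (t.2.2 < 6))%N omega_terms by [].
  under eq_bigr => f _ do rewrite /om /pullback omega_of_sum coframeE // !mulr_suml.
  rewrite exchange_big; apply: eq_big_seq => t /(allP omega_lt)/andP[a6 b6] /=.
  rewrite (bigD1 (F t.2.1 t.2.2)) //= big1 => [|f fF].
    rewrite !coord_fst_ext_frame // coord_ext_frame_tnth //.
    by rewrite -val_eqE /= !FE //= inordK // !eqxx !mulr1 addr0.
  rewrite !coord_fst_ext_frame // coord_ext_frame_tnth //.
  case: eqP => [f0|]; last by rewrite !(mulr0, mul0r).
  case: eqP => [f1|]; last by rewrite !(mulr0, mul0r).
  case: eqP => [f2|]; last by rewrite !(mulr0, mul0r).
  case/eqP: fF; apply/ffunP => i; apply: val_inj; rewrite /= FE //.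
  case: (split_ordP (i : 'I_(2 + 1))) => [k|k]; case: k => [[|[|]]] //= k2 ik.
  - have -> : i = lshift 1 ord0 :> 'I_(2 + 1) by rewrite ik; apply: val_inj.
    by rewrite f0.
  - have -> : i = lshift 1 ord_max :> 'I_(2 + 1) by rewrite ik; apply: val_inj.
    by rewrite f1.
  - have -> : i = rshift 2 ord0 :> 'I_(2 + 1) by rewrite ik; apply: val_inj.
    by rewrite f2 /= inordK.
rewrite omega_square /omega_terms !(big_cons, big_nil) /= /G.
rewrite !(fun a b a6 b6 ab => @frame_det_vertical a b (F a b) a6 b6 ab
  (fun i => FE a b i a6 b6)) // /bump /unbump /=.
rewrite !ndet4 /=.
(* In [omega ⋀ omega], two terms sharing an index give a determinant with a repeated column, hence
   0; the other pairs use the four indices complementary to the remaining plane of omega. *)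
move: (coordn e y) => c.
by field.
Qed.

End Star.

(** * Restriction of the torsion equations to n *)

Section Restriction.
Context {R : realType} {V : vectType R} (br : V -> V -> V) (D : 'End(V)).

Lemma incl_bracket : {morph @incl R V : x y / br x y >-> ext_bracket br D x y}.
Proof. by move=> x y; rewrite /ext_bracket /incl /= !scale0r addr0 subr0. Qed.

Lemma closed_form1_incl (tau : {linear ext V -> R^o}) :
  lker D = 0%VS -> (forall v, br 0 v = 0) ->
  CE_d (ext_bracket br D) (form1 tau : kform R (ext V) 1) = 0 ->
  pullback (@incl R V) (form1 tau : kform R (ext V) 1) = 0.
Proof.
move=> kerD br0 dtau; apply/funext => x; rewrite /pullback /form1 /=.
have -> : x ord0 = D ((D^-1)%VF (x ord0)) by rewrite lker0_lfunVK ?kerD.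
set v := ((D^-1)%VF _).
have := congr1 (fun a : kform R (ext V) 2 =>
  a (fun i => if i == ord0 then (0, 1) else incl v)) dtau.
(* On a 1-form only [i = j = 0] contributes, with sign [(-1) ^+ (0 + 1)]. *)
rewrite /CE_d !big_ord_recl big_ord0 /= !big_mkcond !big_ord_recl !big_ord0 /=.
rewrite /form1 /catf; case: split_ordP => // j _ /=.
rewrite /ext_bracket /= br0 add0r scale1r scale0r subr0 !addr0 expr1 mulN1r.
by move/eqP; rewrite oppr_eq0 => /eqP.
Qed.

Lemma pullback_CE_d_eq0 (tau : {linear ext V -> R^o}) k m (a : kform R (ext V) k.+1) :
  pullback (@incl R V) (form1 tau : kform R (ext V) 1) = 0 ->
  CE_d (ext_bracket br D) a = ((form1 tau : kform R (ext V) 1) ⋀ a) *+ m ->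
  CE_d br (pullback (@incl R V) a) = 0.
Proof.
move=> tau0 da; rewrite (CE_d_pullback _ incl_bracket) da.
apply/funext => x; rewrite /pullback natmulfctE.
(* Pullback commutes with the wedge by computation, since both act argument by argument. *)
rewrite -[X in X *+ m]/((pullback (@incl R V) (form1 tau : kform R (ext V) 1)
  ⋀ pullback (@incl R V) a) x).
by rewrite tau0 wedge0 mul0rn.
Qed.

End Restriction.

Theorem lemma4p2 (R : realType) (n : vectType R) (br : n -> n -> n)
    (omega : kform R n 2) (psi : kform R n 3) (e : 6.-tuple n) (D : 'End(n)) :
  lie_bracket br ->
  nilpotent_bracket br ->
  SU3_structure omega psi e ->
  derivation br D ->
  lker D = 0%VS ->
  self_adjoint e D ->
  (forall i : 'I_6, exists a : R, D (tnth e i) = a *: tnth e i) ->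
  conformally_parallel br D e (G2_form e omega psi) ->
  half_flat br omega psi.
Proof.
move=> [_ brl _ _] _ [e_basis omegaE psiE] _ kerD _ _ [tau [dtau dphi dstar]].
have br0 v : br 0 v = 0.
  (* With scalar -1, linearity reads [br 0 v = - br 0 v + br 0 v]. *)
  by have := brl v (-1) 0 0; rewrite scaler0 addr0 scaleN1r addNr.
have tau0 := closed_form1_incl kerD br0 dtau.
have e7_incl (x : 'I_1 -> n) : coframe (ext_frame e) 7 (@incl R n \o x) = 0.
  by rewrite coframeE //= (coord_incl e_basis) inordK.
split.
  have := pullback_CE_d_eq0 tau0 dphi; congr (CE_d _ _ = 0).
  apply/funext => x; rewrite /pullback /G2_form.
  rewrite -[LHS]/((pullback fst omega ⋀ coframe (ext_frame e) 7 : kform R (ext n) 3)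
    (* Every summand of the wedge has a factor e^7 evaluated on a vector of n. *)
    (@incl R n \o x) + psi x) /wedge big1 ?mulr0 ?add0r // => s _.
  by rewrite (e7_incl (fun j => x (s (rshift 2 j)))) mulr0.
have := pullback_CE_d_eq0 tau0 dstar; rewrite omegaE psiE.
rewrite (_ : pullback _ _ = fun y => 2%:R^-1 * (omega_of e ⋀ omega_of e) y); last first.
  by apply/funext => y; apply: pullback_G2_star.
(* The nonzero constant 1/2 moves out of the differential and cancels. *)
rewrite CE_dZ => d0; apply/funext => x.
have /eqP := congr1 (fun a : kform R n 5 => a x) d0.
by rewrite mulf_eq0 invr_eq0 pnatr_eq0 /= => /eqP.
Qed.
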